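(* A nonempty metric space $(X,d)$ is isometric to its $\ell^\infty$-square $X\times_\infty X$ if and only if there exists a reconstructive binary branch system whose associated metric space $(S,d_{\sup})$ is isometric to $(X,d)$. For such a reconstructive binary branch system, the associated map $\Theta:S\to S\times_\infty S$ is a bijective isometry from $(S,d_{\sup})$ to $(S\times S,d_\infty)$, where $d_\infty((u,v),(u',v'))=\max\{d_{\sup}(u,u'),d_{\sup}(v,v')\}$.
   Context: All metric spaces are nonempty and all isometries are bijective. $X\times_\infty X$ is $X\times X$ with metric $\max\{d(x_0,y_0),d(x_1,y_1)\}$. Let $\Sigma:=\{0,1\}^{\mathbb N}$ be the set of infinite binary sequences; for $i\in\{0,1\}$ and $\beta=(\beta_1,\beta_2,\dots)\in\Sigma$, put $i\beta:=(i,\beta_1,\beta_2,\dots)$. A reconstructive binary branch system consists of metric spaces $(M_\beta,\rho_\beta)$ indexed by $\beta\in\Sigma$, isometries $\alpha_i^\beta:M_{i\beta}\to M_\beta$ for $i\in\{0,1\}$ and $\beta\in\Sigma$, and a subset $S\subseteq\prod_{\beta\in\Sigma}M_\beta$, such that, with $$d_{\sup}(z,z'):=\sup_{\beta\in\Sigma}\rho_\beta(z_\beta,z'_\beta),\qquad L(z)_\beta:=\alpha_0^\beta(z_{0\beta}),\qquad R(z)_\beta:=\alpha_1^\beta(z_{1\beta}),\qquad \Theta(z):=(L(z),R(z)),$$ the following hold: (1) $d_{\sup}$ defines a (finite-valued) metric on $S$; (2) $L$ and $R$ map $S$ into itself; (3) $\Theta:S\to S\times S$ is bijective. *)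

(* Defs.v *)
From HB Require Import structures.
From mathcomp Require Import all_boot all_order all_algebra.
From mathcomp Require Import all_classical all_reals all_analysis.

Set Implicit Arguments.
Unset Strict Implicit.
Unset Printing Implicit Defensive.

Import Order.TTheory GRing.Theory Num.Theory.

Local Open Scope classical_set_scope.
Local Open Scope ring_scope.

(* The library already equips [X * Y] with the product of balls as its
   pseudometric structure; the compatible distance is the max distance, so
   [X * Y] below is the l^infty product. *)
Section l_infty_product.
Context {R : realType} (X Y : metricType R).
Implicit Types p q : X * Y.

Definition max_dist p q : R := Num.max (mdist p.1 q.1) (mdist p.2 q.2).

Let max_dist_ge0 p q : 0 <= max_dist p q.
Proof. by rewrite le_max mdist_ge0. Qed.

Let max_dist_positivity p q : max_dist p q = 0 -> p = q.
Proof.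
case: p q => [x y] [x' y'] /= d0; congr pair; apply: mdist_positivity;
  by apply/eqP; rewrite eq_le mdist_ge0 -d0 le_max lexx ?orbT.
Qed.

Let ball_max_dist p e : ball p e = [set q | max_dist p q < e].
Proof.
apply/seteqP; split=> [q [] | q] /=.
  by rewrite !ballEmdist /= /max_dist gt_max => -> ->.
by rewrite /max_dist gt_max => /andP[pq1 pq2]; split; rewrite ballEmdist.
Qed.

HB.instance Definition _ := PseudoMetric_isMetric.Build R (X * Y)%type
  max_dist_ge0 max_dist_positivity ball_max_dist.

End l_infty_product.

Definition is_isometry {R : realType} {X Y : metricType R} (f : X -> Y) : Prop :=
  bijective f /\ forall x y, mdist (f x) (f y) = mdist x y.

Definition isometric {R : realType} (X Y : metricType R) : Prop :=
  exists f : X -> Y, is_isometry f.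

(* [d] takes extended real values: being finite is part of being a metric. *)
Record metric_on {R : realType} {T : Type} (A : set T) (d : T -> T -> \bar R) :
    Prop := MetricOn {
  metric_on_fin : forall x y, A x -> A y -> d x y \is a fin_num;
  metric_on_ge0 : forall x y, A x -> A y -> (0 <= d x y)%E;
  metric_on_eq0 : forall x y, A x -> A y -> (d x y = 0%E <-> x = y);
  metric_on_sym : forall x y, A x -> A y -> d x y = d y x;
  metric_on_triangle : forall x y z, A x -> A y -> A z ->
    (d x z <= d x y + d y z)%E }.

(* Binary sequences, indexed from 0: [b 0] is the first term.
   The digits 0 and 1 are [false] and [true]. *)
Definition binseq : Type := nat -> bool.

Definition bcons (i : bool) (b : binseq) : binseq :=
  fun n => if n is m.+1 then b m else i.

Record branch_data (R : realType) := BranchData {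
  branch_space : binseq -> metricType R;
  branch_map : forall (i : bool) (b : binseq),
    branch_space (bcons i b) -> branch_space b;
  branch_set : set (forall b, branch_space b) }.

Arguments branch_set {R} _ _.

Section branch_data_theory.
Context {R : realType} (D : branch_data R).
Implicit Types z : forall b, branch_space D b.

Definition dsup z z' : \bar R :=
  ereal_sup (range (fun b => (mdist (z b) (z' b))%:E)).

Definition branchL z : forall b, branch_space D b :=
  fun b => branch_map (z (bcons false b)).

Definition branchR z : forall b, branch_space D b :=
  fun b => branch_map (z (bcons true b)).

End branch_data_theory.

(* The explicit nonemptiness conditions, here and for [X] in the theorem, reflect
   the convention that metric spaces are nonempty, which [metricType] does not
   impose. *)
Record reconstructive {R : realType} (D : branch_data R) : Prop :=
    Reconstructive {
  branch_space_nonempty : forall b, [set: branch_space D b] !=set0;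
  branch_map_isometry : forall i b, is_isometry (@branch_map R D i b);
  branch_set_nonempty : branch_set D !=set0;
  dsup_metric : metric_on (branch_set D) (@dsup R D);
  branchL_stable : set_fun (branch_set D) (branch_set D) (@branchL R D);
  branchR_stable : set_fun (branch_set D) (branch_set D) (@branchR R D);
  branchLR_bij : set_bij (branch_set D) (branch_set D `*` branch_set D)
    (fun z => (branchL z, branchR z)) }.

Record branch_system (R : realType) := BranchSystem {
  branch_system_data :> branch_data R;
  branch_systemP : reconstructive branch_system_data }.

Definition assoc_space {R : realType} (B : branch_system R) : Type :=
  {z : forall b, branch_space B b | branch_set B z}.

Section assoc_space_metric.
Context {R : realType} (B : branch_system R).
Implicit Types u v w : assoc_space B.

HB.instance Definition _ := gen_eqMixin (assoc_space B).
HB.instance Definition _ := gen_choiceMixin (assoc_space B).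

Definition assoc_dist u v : R := fine (dsup (sval u) (sval v)).

Let Bmetric := dsup_metric (branch_systemP B).

Let assoc_distxx u : assoc_dist u u = 0.
Proof.
case: u => z Sz; rewrite /assoc_dist /=.
by have /(metric_on_eq0 Bmetric Sz Sz) -> : z = z by [].
Qed.

Let assoc_dist_positivity u v : assoc_dist u v = 0 -> u = v.
Proof.
case: u v => [z Sz] [z' Sz'] /= d0; apply: eq_exist => /=.
apply/(metric_on_eq0 Bmetric Sz Sz').
by rewrite -(fineK (metric_on_fin Bmetric Sz Sz')); congr EFin.
Qed.

Let assoc_dist_sym u v : assoc_dist u v = assoc_dist v u.
Proof.
by rewrite /assoc_dist (metric_on_sym Bmetric (svalP u) (svalP v)).
Qed.

Let assoc_dist_triangle v u w :
  assoc_dist u w <= assoc_dist u v + assoc_dist v w.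
Proof.
have finB x y := metric_on_fin Bmetric (svalP x) (svalP y).
rewrite -lee_fin EFinD /assoc_dist !fineK ?finB //.
exact: (metric_on_triangle Bmetric (svalP u) (svalP v) (svalP w)).
Qed.

HB.instance Definition _ := isMetric.Build R (assoc_space B)
  assoc_distxx assoc_dist_positivity assoc_dist_sym assoc_dist_triangle.

Definition theta u : assoc_space B * assoc_space B :=
  (exist _ (branchL (sval u)) (branchL_stable (branch_systemP B) (svalP u)),
   exist _ (branchR (sval u)) (branchR_stable (branch_systemP B) (svalP u))).

End assoc_space_metric.

(* Main.v *)
Require Import Defs.
From HB Require Import structures.
From mathcomp Require Import all_boot all_order all_algebra.
From mathcomp Require Import all_classical all_reals all_analysis.

(** Let [phi : X -> X * X] be an isometry, and call the two components of
    [phi x] its children.  Since [phi] preserves the max distance, [mdist x y] is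
    the larger of the distances between the left children and between the right
    children.  Follow a binary sequence [b] down the resulting tree: the distances
    between the [n]-th descendants of [x] and [y] along [b] do not increase, so
    they have a limit [rho b x y], a pseudometric on [X].  Take as branch space
    the metric quotient of [X] by [rho b], as branch maps the maps induced by
    taking a child ([along_limit_bcons]: passing to the tail of [b] replaces the
    points by their children), and as [S] the set of the threads
    [b |-> class of x].  These are isometries because both child maps are
    surjective.

    The point is that [S] has the same metric as [X].  No [rho b] exceeds
    [mdist], and choosing at every step a child that realizes the maximum gives a
    sequence along which the distance never drops, so the supremum over [b] is
    attained and equals [mdist x y] ([dsup_thread]).  Hence [x |-> thread x] is an
    isometry of [X] onto [S], and it carries [phi] to [Theta], which is therefore
    bijective.

    Conversely, for any reconstructive system, every binary sequence is [bcons] of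
    its first term and its tail, and the branch maps are isometries, so the
    supremum defining [dsup] splits into the maximum of two suprema:
    [dsup z z' = maxe (dsup (L z) (L z')) (dsup (R z) (R z'))].  Thus [Theta] is
    an isometry, and an isometry of [S] with [X] transports it to [X]. *)

Set Implicit Arguments.
Unset Strict Implicit.
Unset Printing Implicit Defensive.

Import Order.TTheory GRing.Theory Num.Theory.
Import numFieldNormedType.Exports.

Local Open Scope classical_set_scope.
Local Open Scope ring_scope.

(** * Isometries *)

Section isometries.
Context {R : realType}.
Implicit Types X Y Z : metricType R.

Lemma bijective_inj_surj (T U : Type) (f : T -> U) :
  injective f -> (forall y, exists x, f x = y) -> bijective f.
Proof.
move=> f_inj f_surj; have [g gK] := choice f_surj.
by exists g => // x; apply: f_inj; rewrite gK.
Qed.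

Lemma surj_is_isometry X Y (f : X -> Y) :
  (forall x x', mdist (f x) (f x') = mdist x x') ->
  (forall y, exists x, f x = y) -> is_isometry f.
Proof.
move=> f_dist f_surj; split=> //; apply: bijective_inj_surj => // x x' fxx'.
by apply: mdist_positivity; rewrite -f_dist fxx' mdistxx.
Qed.

Lemma is_isometry_surj X Y (f : X -> Y) :
  is_isometry f -> forall y, exists x, f x = y.
Proof. by move=> [[g _ gK] _] y; exists (g y). Qed.

Lemma isometric_sym X Y : isometric X Y -> isometric Y X.
Proof.
move=> [f [[g fK gK] f_dist]]; exists g; split; first by exists f.
by move=> y y'; rewrite -f_dist !gK.
Qed.

Lemma isometric_trans Y X Z : isometric X Y -> isometric Y Z -> isometric X Z.
Proof.
move=> [f [f_bij f_dist]] [g [g_bij g_dist]]; exists (g \o f); split.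
  exact: bij_comp.
by move=> x x'; rewrite /= g_dist f_dist.
Qed.

Lemma isometric_square X Y :
  isometric X Y -> isometric (X * X)%type (Y * Y)%type.
Proof.
move=> [f [[g fK gK] f_dist]].
exists (fun p => (f p.1, f p.2)); split.
  by exists (fun q => (g q.1, g q.2)) => -[a b] /=; rewrite ?fK ?gK.
by move=> [a b] [a' b']; rewrite /mdist /= /max_dist /= !f_dist.
Qed.

End isometries.

(** * The metric quotient of a pseudometric *)

Record pseudometric (R : realType) (T : Type) := Pseudometric {
  pdist :> T -> T -> R;
  pdistxx : forall x, pdist x x = 0;
  pdist_sym : forall x y, pdist x y = pdist y x;
  pdist_triangle : forall y x z, pdist x z <= pdist x y + pdist y z }.

(** Encoding classes as sets makes two points at distance [0] have equal classes
    by extensionality. *)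
Definition metric_quotient (R : realType) (T : Type) (p : pseudometric R T) :
    Type :=
  {A : set T | exists x, A = [set y | p x y = 0]}.

Section metric_quotient_theory.
Context {R : realType} {T : Type} (p : pseudometric R T).
Implicit Types u v w : metric_quotient p.

Definition quotient_class (x : T) : metric_quotient p :=
  exist _ [set y | p x y = 0] (ex_intro _ x erefl).

Definition quotient_repr u : T := projT1 (cid (svalP u)).

Lemma quotient_reprK u : quotient_class (quotient_repr u) = u.
Proof.
rewrite /quotient_repr; case: cid => x /=; case: u => A Ax /= Aclass.
exact: eq_exist.
Qed.

Lemma pdist0_eqr x y z : p x y = 0 -> p z x = p z y.
Proof.
move=> xy0; apply/eqP; rewrite eq_le.
have := pdist_triangle p y z x; rewrite (pdist_sym p y x) xy0 addr0 => ->.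
by have := pdist_triangle p x z y; rewrite xy0 addr0.
Qed.

Lemma quotient_class_eq x y : p x y = 0 <-> quotient_class x = quotient_class y.
Proof.
split=> [xy0 | /(congr1 sval) /= xy].
  apply: eq_exist => /=; apply/seteqP; split=> z /=;
    by rewrite (pdist_sym p x) (pdist_sym p y) (pdist0_eqr _ xy0).
have : [set z | p y z = 0] y by rewrite /= pdistxx.
by rewrite -xy.
Qed.

Definition quotient_dist u v : R := p (quotient_repr u) (quotient_repr v).

Lemma quotient_dist_class x y :
  quotient_dist (quotient_class x) (quotient_class y) = p x y.
Proof.
have reprP z : p (quotient_repr (quotient_class z)) z = 0.
  by apply/quotient_class_eq; rewrite quotient_reprK.
rewrite /quotient_dist (pdist0_eqr _ (reprP y)) pdist_sym.
by rewrite (pdist0_eqr _ (reprP x)) pdist_sym.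
Qed.

Let quotient_distxx u : quotient_dist u u = 0.
Proof. exact: pdistxx. Qed.

Let quotient_dist_positivity u v : quotient_dist u v = 0 -> u = v.
Proof. by move=> /quotient_class_eq; rewrite !quotient_reprK. Qed.

Let quotient_dist_sym u v : quotient_dist u v = quotient_dist v u.
Proof. exact: pdist_sym. Qed.

Let quotient_dist_triangle v u w :
  quotient_dist u w <= quotient_dist u v + quotient_dist v w.
Proof. exact: pdist_triangle. Qed.

HB.instance Definition _ := gen_eqMixin (metric_quotient p).
HB.instance Definition _ := gen_choiceMixin (metric_quotient p).
HB.instance Definition _ := isMetric.Build R (metric_quotient p)
  quotient_distxx quotient_dist_positivity quotient_dist_sym
  quotient_dist_triangle.

Lemma mdist_class x y :
  mdist (quotient_class x) (quotient_class y) = p x y.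
Proof. exact: quotient_dist_class. Qed.

End metric_quotient_theory.

(** * Limit pseudometrics along binary sequences *)

Section limit_pseudometric.
Context {R : realType} (X : metricType R) (child : bool -> X -> X).
Hypothesis mdist_child : forall x y,
  mdist x y = Num.max (mdist (child false x) (child false y))
                      (mdist (child true x) (child true y)).
Implicit Types (b : binseq) (x y z : X).

Fixpoint descendant b n x : X :=
  if n is m.+1 then child (b m) (descendant b m x) else x.

Lemma descendant_bcons i b n x :
  descendant (bcons i b) n.+1 x = descendant b n (child i x).
Proof. by elim: n => // n; rewrite /= => ->. Qed.

Lemma mdist_child_le i x y : mdist (child i x) (child i y) <= mdist x y.
Proof. by rewrite (mdist_child x y) le_max; case: i; rewrite lexx ?orbT. Qed.

Definition descendant_dist b x y : R ^nat :=
  fun n => mdist (descendant b n x) (descendant b n y).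

Lemma descendant_dist_nonincreasing b x y :
  nonincreasing_seq (descendant_dist b x y).
Proof. by apply/nonincreasing_seqP => n; exact: mdist_child_le. Qed.

Lemma is_cvg_descendant_dist b x y : cvgn (descendant_dist b x y).
Proof.
apply: nonincreasing_is_cvgn; first exact: descendant_dist_nonincreasing.
by exists 0 => _ [n _ <-]; exact: mdist_ge0.
Qed.

Definition along_limit b x y : R := limn (descendant_dist b x y).

Let along_limitxx b x : along_limit b x x = 0.
Proof.
rewrite /along_limit (_ : descendant_dist b x x = fun=> 0) ?lim_cst //.
by apply/funext => n; exact: mdistxx.
Qed.

Let along_limit_sym b x y : along_limit b x y = along_limit b y x.
Proof. by congr (limn _); apply/funext => n; exact: metric_sym. Qed.

Let along_limit_triangle b y x z :
  along_limit b x z <= along_limit b x y + along_limit b y z.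
Proof.
rewrite /along_limit -limD; [|exact: is_cvg_descendant_dist..].
apply: ler_lim; [exact: is_cvg_descendant_dist| |].
  by apply: is_cvgD; exact: is_cvg_descendant_dist.
by apply: nearW => n; exact: metric_triangle.
Qed.

Definition limit_pseudometric b : pseudometric R X :=
  Pseudometric (along_limitxx b) (along_limit_sym b) (@along_limit_triangle b).

(** Prepending [i] to [b] only adds a term in front of the sequence of distances,
    which does not affect its limit.  This makes [child i] compatible with the
    quotients at [bcons i b] and at [b], and distance preserving between them. *)
Lemma along_limit_bcons i b x y :
  along_limit (bcons i b) x y = along_limit b (child i x) (child i y).
Proof.
apply: cvg_lim => //; rewrite -cvg_shiftS.
rewrite (_ : [sequence _]_n = descendant_dist b (child i x) (child i y)).
  exact: is_cvg_descendant_dist.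
by apply/funext => n; rewrite /= /descendant_dist !descendant_bcons.
Qed.

Lemma along_limit_le b x y : along_limit b x y <= mdist x y.
Proof.
exact: (nonincreasing_cvgn_ge (@descendant_dist_nonincreasing b x y)
  (is_cvg_descendant_dist (b := b) (x := x) (y := y)) 0).
Qed.

Definition far_child (xy : X * X) : bool :=
  mdist (child false xy.1) (child false xy.2) <
  mdist (child true xy.1) (child true xy.2).

Lemma mdist_far_child x y (i := far_child (x, y)) :
  mdist (child i x) (child i y) = mdist x y.
Proof.
rewrite {}/i (mdist_child x y) /far_child /= /Num.max /Order.max.
by case: ifP.
Qed.

(** The greedy sequence: the pair of descendants is iterated together with the
    choice of the child at which their distance does not drop. *)
Lemma along_limit_attained x y : exists b, along_limit b x y = mdist x y.
Proof.
pose next (xy : X * X) :=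
  (child (far_child xy) xy.1, child (far_child xy) xy.2).
pose b : binseq := fun n => far_child (iter n next (x, y)).
have descendantE n :
    (descendant b n x, descendant b n y) = iter n next (x, y).
  by elim: n => //= n; rewrite /next /b => <-.
exists b; rewrite /along_limit.
rewrite (_ : descendant_dist b x y = fun=> mdist x y) ?lim_cst //.
apply/funext; elim=> //= n <-.
by rewrite /descendant_dist /= /b -descendantE mdist_far_child.
Qed.

End limit_pseudometric.

(** * The branch system of an isometry onto the square *)

Section square_system.
Context {R : realType} (X : metricType R) (child : bool -> X -> X).
Hypothesis X_neq0 : [set: X] !=set0.
Hypothesis mdist_child : forall x y,
  mdist x y = Num.max (mdist (child false x) (child false y))
                      (mdist (child true x) (child true y)).
Hypothesis child_surj : forall y0 y1, exists x,
  child false x = y0 /\ child true x = y1.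
Implicit Types (b : binseq) (x y : X).

Local Notation rho := (limit_pseudometric mdist_child).

Definition thread x : forall b, metric_quotient (rho b) :=
  fun b => quotient_class (rho b) x.

Definition child_class i b (u : metric_quotient (rho (bcons i b))) :
    metric_quotient (rho b) :=
  quotient_class (rho b) (child i (quotient_repr u)).

Definition square_data : branch_data R :=
  @BranchData R (fun b => metric_quotient (rho b)) child_class (range thread).

Lemma child_class_thread i b x :
  child_class (thread x (bcons i b)) = thread (child i x) b.
Proof.
apply/(quotient_class_eq (rho b)); rewrite /= -(along_limit_bcons mdist_child).
apply/(quotient_class_eq (rho (bcons i b))).
exact: (quotient_reprK (thread x (bcons i b))).
Qed.

Lemma branchL_thread x :
  @branchL _ square_data (thread x) = thread (child false x).
Proof. by apply/functional_extensionality_dep => b; exact: child_class_thread. Qed.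

Lemma branchR_thread x :
  @branchR _ square_data (thread x) = thread (child true x).
Proof. by apply/functional_extensionality_dep => b; exact: child_class_thread. Qed.

(** Distances are preserved by [along_limit_bcons].  The map is onto because every
    point of [X] is a child on either side. *)
Lemma child_class_isometry i b : is_isometry (@child_class i b).
Proof.
apply: surj_is_isometry => [u v | u].
  rewrite -(quotient_reprK u) -(quotient_reprK v) !child_class_thread.
  by rewrite !mdist_class /= (along_limit_bcons mdist_child).
have [x [x0 x1]] := child_surj (quotient_repr u) (quotient_repr u).
exists (thread x (bcons i b)); rewrite child_class_thread.
by rewrite (_ : child i x = quotient_repr u) ?[LHS]quotient_reprK //; case: i.
Qed.

(** No branch exceeds the distance of [X], and the greedy branch attains it. *)
Lemma dsup_thread x y :
  @dsup _ square_data (thread x) (thread y) = (mdist x y)%:E.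
Proof.
apply/eqP; rewrite eq_le; apply/andP; split.
  apply: ge_ereal_sup => _ [b _ <-].
  by rewrite lee_fin [X in X <= _]mdist_class along_limit_le.
have [b bE] := along_limit_attained mdist_child x y.
apply: ereal_sup_ubound; exists b => //; congr EFin.
by rewrite [LHS]mdist_class.
Qed.

Lemma thread_inj : injective thread.
Proof.
move=> x y xy; apply: mdist_positivity; apply: EFin_inj.
by rewrite -dsup_thread xy dsup_thread mdistxx.
Qed.

Lemma square_data_reconstructive : reconstructive square_data.
Proof.
have [x0 _] := X_neq0; split.
- by move=> b; exists (thread x0 b).
- exact: child_class_isometry.
- by exists (thread x0), x0.
- split.
  + by move=> _ _ [x _ <-] [y _ <-]; rewrite dsup_thread.
  + by move=> _ _ [x _ <-] [y _ <-]; rewrite dsup_thread lee_fin mdist_ge0.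
  + move=> _ _ [x _ <-] [y _ <-]; rewrite dsup_thread; split=> [[] | /thread_inj ->].
      by move=> /mdist_positivity ->.
    by rewrite mdistxx.
  + by move=> _ _ [x _ <-] [y _ <-]; rewrite !dsup_thread metric_sym.
  + move=> _ _ _ [x _ <-] [y _ <-] [z _ <-].
    by rewrite !dsup_thread -EFinD lee_fin metric_triangle.
- by move=> _ [x _ <-]; rewrite branchL_thread; exists (child false x).
- by move=> _ [x _ <-]; rewrite branchR_thread; exists (child true x).
- split.
  + move=> _ [x _ <-]; rewrite branchL_thread branchR_thread.
    by split; [exists (child false x) | exists (child true x)].
  + move=> _ _ /set_mem [x _ <-] /set_mem [y _ <-].
    rewrite !branchL_thread !branchR_thread => -[/thread_inj xy0 /thread_inj xy1].
    congr thread; apply: mdist_positivity.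
    by rewrite mdist_child xy0 xy1 !mdistxx maxxx.
  + move=> [_ _] /= [[y0 _ <-] [y1 _ <-]].
    have [x [<- <-]] := child_surj y0 y1.
    by exists (thread x); [exists x | rewrite branchL_thread branchR_thread].
Qed.

Definition square_system : branch_system R :=
  BranchSystem square_data_reconstructive.

Lemma square_system_isometric : isometric (assoc_space square_system) X.
Proof.
apply: isometric_sym.
have threadP x : branch_set square_system (thread x) by exists x.
exists (fun x => exist _ (thread x) (threadP x)).
apply: surj_is_isometry => [x y | [z Sz]].
  rewrite [LHS](_ : _ = fine (@dsup _ square_data (thread x) (thread y))) //.
  by rewrite dsup_thread.
by have [x _ xz] := Sz; exists x; exact: eq_exist.
Qed.

End square_system.

(** * The reconstruction map is an isometry *)

Section theta_isometry.
Context {R : realType}.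

Lemma bcons_head_tail (b : binseq) : bcons (b 0) (b \o S) = b.
Proof. by apply/funext; case. Qed.

(** The supremum over all [b] is split according to the first term of [b]; the
    branch maps turn the part at [bcons i b] into a distance between the images
    at [b]. *)
Lemma dsup_branch (D : branch_data R) (z z' : forall b, branch_space D b) :
  (forall i b, is_isometry (@branch_map R D i b)) ->
  dsup z z' = maxe (dsup (branchL z) (branchL z')) (dsup (branchR z) (branchR z')).
Proof.
move=> D_iso; have D_dist i b := (D_iso i b).2.
apply/eqP; rewrite eq_le; apply/andP; split.
  apply: ge_ereal_sup => _ [b _ <-]; rewrite -(bcons_head_tail b) -D_dist le_max.
  by apply/orP; case: (b 0); [right | left]; apply: ereal_sup_ubound; exists (b \o S).
rewrite ge_max; apply/andP; split; apply: ge_ereal_sup => _ [b _ <-];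
  by rewrite /branchL /branchR D_dist; apply: ereal_sup_ubound; eexists.
Qed.

Lemma theta_is_isometry (B : branch_system R) : is_isometry (@theta R B).
Proof.
have [_ D_iso _ D_metric SL SR [_ _ D_surj]] := branch_systemP B.
apply: surj_is_isometry => [[z Sz] [z' Sz'] | [[u Su] [v Sv]]].
  rewrite [RHS](_ : _ = fine (dsup z z')) // (dsup_branch z z' D_iso).
  have finS x y : branch_set B x -> branch_set B y ->
      exists r, dsup x y = r%:E.
    by move=> Sx Sy; have /fineK <- := metric_on_fin D_metric Sx Sy; eexists.
  rewrite /mdist /= /max_dist /mdist /= /assoc_dist /=.
  have [l ->] := finS _ _ (SL _ Sz) (SL _ Sz').
  have [r ->] := finS _ _ (SR _ Sz) (SR _ Sz').
  by rewrite -EFin_max.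
have [z Sz [zu zv]] := D_surj (u, v) (conj Su Sv).
by exists (exist _ z Sz); congr pair; exact: eq_exist.
Qed.

End theta_isometry.

Theorem theorem1p4 (R : realType) :
  (forall X : metricType R, [set: X] !=set0 ->
     (isometric X (X * X)%type <->
      exists B : branch_system R, isometric (assoc_space B) X)) /\
  (forall B : branch_system R, is_isometry (@theta R B)).
Proof.
split=> [X X_neq0|]; last exact: theta_is_isometry.
split=> [[phi [phi_bij phi_dist]] | [B BX]].
  pose child (i : bool) x := if i then (phi x).2 else (phi x).1.
  have mdist_child x y : mdist x y =
      Num.max (mdist (child false x) (child false y))
              (mdist (child true x) (child true y)).
    by rewrite -phi_dist.
  have child_surj y0 y1 : exists x, child false x = y0 /\ child true x = y1.
    have [x xE] := is_isometry_surj (conj phi_bij phi_dist) (y0, y1).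
    by exists x; rewrite /child xE.
  exists (square_system X_neq0 mdist_child child_surj).
  exact: square_system_isometric.
apply: (isometric_trans (isometric_sym BX)).
apply: isometric_trans (isometric_square BX).
by exists (@theta R B); exact: theta_is_isometry.
Qed.
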